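(* Let $\mu,\nu$ be Borel probability measures on $\mathbb{R}^d$ such that: (a) there is a bounded connected open Lipschitz domain $\Omega\subset B(0,1)$ with $\mu(dx)=\rho_\mu(x)\mathbf 1_\Omega(x)dx$ and $0<\underline\lambda_\mu\le\rho_\mu\le\overline\lambda_\mu<\infty$ a.e. on $\Omega$; (b) $\nu\ll\mathrm{Leb}$, $\operatorname{spt}\nu\subseteq B(0,1)$, $d\nu/dy\le\overline\lambda_\nu<\infty$ on $\operatorname{spt}\nu$; (c) the Monge map $T=\nabla\varphi$ is $L$-Lipschitz. Let $C_{\mathrm{val}}$ be a constant with $C_{\mathrm{val}}^{-1}\varepsilon^{2/(2+d)}\le\Delta_\varepsilon\le C_{\mathrm{val}}\varepsilon^{2/(2+d)}$ for all $\varepsilon\in(0,1]$. Then for every $t>0$ and $\varepsilon\in(0,1]$, $$\pi_\varepsilon\big(\{(x,y):\|y-T(x)\|\ge t\}\big)\le\frac{2LC_{\mathrm{val}}}{t^2}\varepsilon^{\frac{2}{d+2}}.$$ Equivalently, for every $\eta\in(0,1)$, $$\pi_\varepsilon\Big(\big\{(x,y):\|y-T(x)\|\le\sqrt{2LC_{\mathrm{val}}}\,\eta^{-1/2}\varepsilon^{\frac1{d+2}}\big\}\Big)\ge1-\eta.$$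
   Context: Cost $c(x,y)=\frac12\|x-y\|^2$, $P=\mu\otimes\nu$, $\mathrm{OT}(\mu,\nu)=\inf_{\pi\in\Pi(\mu,\nu)}\int c\,d\pi$; $T=\nabla\varphi$ ($\varphi$ convex) is the Brenier optimal map with $T_\#\mu=\nu$. For $\varepsilon>0$, $\mathrm{QOT}_\varepsilon(\mu,\nu)=\inf_{\pi\in\Pi(\mu,\nu),\pi\ll P}\{\int c\,d\pi+\frac\varepsilon2\|\frac{d\pi}{dP}\|^2_{L^2(P)}\}$, $\pi_\varepsilon$ its unique optimizer, $\Delta_\varepsilon=\mathrm{QOT}_\varepsilon(\mu,\nu)-\mathrm{OT}(\mu,\nu)$. *)

(* Defs.v *)
From HB Require Import structures.
From mathcomp Require Import all_boot all_order all_algebra.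
From mathcomp Require Import all_classical all_reals all_analysis.
Import Order.TTheory GRing.Theory Num.Theory.
Import numFieldNormedType.Exports.
Local Open Scope classical_set_scope.
Local Open Scope ring_scope.

Set Implicit Arguments.
Unset Strict Implicit.
Unset Printing Implicit Defensive.

Definition Rd (R : realType) (d : nat) := g_sigma_algebraType (@open 'rV[R]_d).

Section Defs.
Variables (R : realType) (d : nat).

Definition dotv (x y : 'rV[R]_d) : R := \sum_(i < d) x ord0 i * y ord0 i.
Definition enorm (x : 'rV[R]_d) : R := Num.sqrt (dotv x x).

Definition eball (c : 'rV[R]_d) (r : R) : set 'rV[R]_d :=
  [set x | enorm (x - c) < r].

Definition cost (z : Rd R d * Rd R d) : R :=
  (enorm ((z.1 : 'rV[R]_d) - z.2)) ^+ 2 / 2.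

(** Lebesgue measure on R^d: the Borel measure giving every closed box
    prod_i [a_i, b_i] its volume prod_i (b_i - a_i)  (this determines it
    uniquely). *)
Definition is_lebesgue_measure (leb : {measure set (Rd R d) -> \bar R}) :=
  forall a b : 'rV[R]_d, (forall i, a ord0 i <= b ord0 i) ->
    leb [set x : Rd R d | forall i, a ord0 i <= (x : 'rV[R]_d) ord0 i <= b ord0 i]
    = (\prod_(i < d) (b ord0 i - a ord0 i))%:E.

Definition lipschitz_fun (L : R) (f : 'rV[R]_d -> R) :=
  forall u v, `|f u - f v| <= L * enorm (u - v).
Definition lipschitz_map (L : R) (T : 'rV[R]_d -> 'rV[R]_d) :=
  forall u v, enorm (T u - T v) <= L * enorm (u - v).

(** Lipschitz domain: open set whose boundary is locally the (strict)
    supergraph of a Lipschitz function over a hyperplane: for each boundary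
    point p there are r > 0, a unit normal e and a Lipschitz g such that,
    inside B(p, r),  x is in Omega  iff  <x - p, e> > g(projection of x - p
    onto e^perp). *)
Definition hyperplane_proj (e z : 'rV[R]_d) : 'rV[R]_d := z - dotv z e *: e.

Definition lipschitz_domain (Omega : set 'rV[R]_d) :=
  open Omega /\
  forall p, closure Omega p -> ~ Omega p ->
    exists r : R, 0 < r /\
    exists e : 'rV[R]_d, enorm e = 1 /\
    exists (g : 'rV[R]_d -> R) (K : R), lipschitz_fun K g /\
      forall x, eball p r x ->
        (Omega x <-> g (hyperplane_proj e (x - p)) < dotv (x - p) e).

Definition support (m : set (Rd R d) -> \bar R) : set 'rV[R]_d :=
  [set y | forall r : R, 0 < r -> (0 < m (eball y r))%E].

Definition is_density d' (X : measurableType d') (m P : set X -> \bar R)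
    (f : X -> R) :=
  [/\ measurable_fun setT f, (forall z, 0 <= f z) &
      forall A, measurable A -> m A = (\int[P]_(z in A) (f z)%:E)%E].

Definition hyp_a (leb : {measure set (Rd R d) -> \bar R})
    (mu : probability (Rd R d) R) :=
  exists (Omega : set 'rV[R]_d) (rho : Rd R d -> R) (lam_lo lam_hi : R),
  [/\ lipschitz_domain Omega, connected Omega,
      (exists M : R, forall x, Omega x -> enorm x <= M) &
      Omega `<=` eball 0 1] /\
  [/\ measurable_fun setT rho,
      (forall A : set (Rd R d), measurable A ->
          mu A = (\int[leb]_(x in A `&` (Omega : set (Rd R d))) (rho x)%:E)%E),
      0 < lam_lo /\ lam_lo <= lam_hi &
      {ae leb, forall x : Rd R d, Omega x -> lam_lo <= rho x <= lam_hi}].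

Definition hyp_b (leb : {measure set (Rd R d) -> \bar R})
    (nu : probability (Rd R d) R) :=
  [/\ nu `<< leb,
      support nu `<=` eball 0 1 &
      exists (g : Rd R d -> R) (lam : R),
        is_density nu leb g /\
        {ae leb, forall y : Rd R d, support nu y -> g y <= lam}].

(** Brenier map T = grad phi, phi convex (and here differentiable
    everywhere, since grad phi is assumed Lipschitz), with T#mu = nu. *)
Definition is_brenier_map (mu nu : probability (Rd R d) R)
    (T : 'rV[R]_d -> 'rV[R]_d) :=
  exists phi : 'rV[R]_d -> R,
    (forall (x y : 'rV[R]_d) (t : R), 0 <= t <= 1 ->
        phi (t *: x + (1 - t) *: y) <= t * phi x + (1 - t) * phi y) /\
    (forall x, differentiable phi x /\
               forall v, 'D_v phi x = dotv (T x) v) /\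
    (forall B : set (Rd R d), measurable B ->
        mu ((T : Rd R d -> Rd R d) @^-1` B) = nu B).

Definition coupling (mu nu : probability (Rd R d) R)
    (pi : probability (Rd R d * Rd R d)%type R) :=
  (forall A : set (Rd R d), measurable A -> pi (A `*` setT) = mu A) /\
  (forall B : set (Rd R d), measurable B -> pi (setT `*` B) = nu B).

Local Open Scope ereal_scope.

Definition OT (mu nu : probability (Rd R d) R) : \bar R :=
  ereal_inf [set v | exists pi : probability (Rd R d * Rd R d)%type R,
     coupling mu nu pi /\ v = \int[pi]_z (cost z)%:E].

Definition QOT_obj (mu nu : probability (Rd R d) R) (eps : R)
    (pi : probability (Rd R d * Rd R d)%type R) (f : Rd R d * Rd R d -> R) :=
  \int[pi]_z (cost z)%:E
  + (eps / 2)%:E * \int[mu \x nu]_z ((f z) ^+ 2)%:E.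

Definition QOT (mu nu : probability (Rd R d) R) (eps : R) : \bar R :=
  ereal_inf [set v | exists (pi : probability (Rd R d * Rd R d)%type R)
                            (f : Rd R d * Rd R d -> R),
     [/\ coupling mu nu pi, is_density pi (mu \x nu) f &
         v = QOT_obj mu nu eps pi f]].

Definition Delta (mu nu : probability (Rd R d) R) (eps : R) : \bar R :=
  QOT mu nu eps - OT mu nu.

Definition is_QOT_optimizer (mu nu : probability (Rd R d) R) (eps : R)
    (pi : probability (Rd R d * Rd R d)%type R) :=
  coupling mu nu pi /\
  exists f, is_density pi (mu \x nu) f /\ QOT_obj mu nu eps pi f = QOT mu nu eps.

End Defs.

(* Main.v *)
(** An L-Lipschitz gradient T = grad phi forces phi to lie below its quadratic
    Taylor majorants, and dually the Fenchel-Young gap obeys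
      phi x + psi y - <x, y> >= |y - T x|^2 / (2 L),
    where psi is the conjugate of phi; the left side vanishes at y = T x.
    Integrating against a coupling pi of mu and nu, the potentials only see
    the marginals, so that the integral of |y - T x|^2 / (2 L) against pi is
    at most (cost of pi) - (cost of T), hence at most Delta when pi is the
    regularized optimizer. Chebyshev's inequality concludes. *)
Require Import Defs.
From HB Require Import structures.
From mathcomp Require Import all_boot all_order all_algebra.
From mathcomp Require Import all_classical all_reals all_analysis.
From mathcomp Require Import measurable_realfun ring lra.
Import Order.TTheory GRing.Theory Num.Theory.
Import numFieldNormedType.Exports.
Local Open Scope classical_set_scope.
Local Open Scope ring_scope.

Set Implicit Arguments.
Unset Strict Implicit.
Unset Printing Implicit Defensive.

(** * Euclidean inner product, norm and continuity *)

Lemma continuous_modulus (R : realType) (V : topologicalType)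
    (W : normedModType R) (f : V -> W) (g : V -> R) x :
  (forall u, `|f x - f u| <= g u) -> g x = 0 ->
  {for x, continuous g} -> {for x, continuous f}.
Proof.
move=> fg gx0 /cvgrPdist_le gc; apply/cvgrPdist_le => e e0.
move: (gc e e0); apply: filterS => u; rewrite gx0 sub0r normrN => h.
by apply: le_trans (fg u) _; apply: le_trans h; exact: ler_norm.
Qed.

Section EuclideanNorm.
Variables (R : realType) (d : nat).
Implicit Types x y z u v : 'rV[R]_d.

Lemma dotvC x y : dotv x y = dotv y x.
Proof. by apply: eq_bigr => i _; rewrite mulrC. Qed.

Lemma dotvDl x y z : dotv (x + y) z = dotv x z + dotv y z.
Proof. by rewrite -big_split; apply: eq_bigr => i _; rewrite !mxE mulrDl. Qed.

Lemma dotvZl (a : R) x y : dotv (a *: x) y = a * dotv x y.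
Proof. by rewrite /dotv mulr_sumr; apply: eq_bigr => i _; rewrite !mxE mulrA. Qed.

Lemma dotvNl x y : dotv (- x) y = - dotv x y.
Proof. by rewrite -scaleN1r dotvZl mulN1r. Qed.

Lemma dotvDr x y z : dotv z (x + y) = dotv z x + dotv z y.
Proof. by rewrite dotvC dotvDl !(dotvC _ z). Qed.

Lemma dotvZr (a : R) x y : dotv y (a *: x) = a * dotv y x.
Proof. by rewrite dotvC dotvZl dotvC. Qed.

Lemma dotvNr x y : dotv y (- x) = - dotv y x.
Proof. by rewrite dotvC dotvNl dotvC. Qed.

Definition dotvE := (dotvDl, dotvDr, dotvNl, dotvNr, dotvZl, dotvZr).

Lemma dotvv_ge0 x : 0 <= dotv x x.
Proof. by apply: sumr_ge0 => i _; rewrite -expr2 sqr_ge0. Qed.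

Lemma enorm_ge0 x : 0 <= enorm x.
Proof. exact: sqrtr_ge0. Qed.

Lemma sqr_enorm x : enorm x ^+ 2 = dotv x x.
Proof. by rewrite sqr_sqrtr // dotvv_ge0. Qed.

Lemma enormZ (a : R) x : enorm (a *: x) = `|a| * enorm x.
Proof. by rewrite /enorm dotvZl dotvZr mulrA -expr2 sqrtrM ?sqr_ge0 // sqrtr_sqr. Qed.

Lemma enormN x : enorm (- x) = enorm x.
Proof. by rewrite -scaleN1r enormZ normrN1 mul1r. Qed.

Lemma enorm0 : enorm (0 : 'rV[R]_d) = 0.
Proof. by rewrite -(scale0r 0) enormZ normr0 mul0r. Qed.

Lemma enorm_eq0 x : enorm x = 0 -> x = 0.
Proof.
move=> x0; have : dotv x x = 0 by rewrite -sqr_enorm x0 expr0n.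
move=> /eqP; rewrite psumr_eq0; last by move=> i _; rewrite -expr2 sqr_ge0.
move=> /allP h; apply/rowP => i; rewrite mxE.
by have := h i (mem_index_enum i); rewrite -expr2 sqrf_eq0 => /eqP.
Qed.

Lemma dotv_le x y : dotv x y <= enorm x * enorm y.
Proof.
have [/enorm_eq0 ->|x0] := eqVneq (enorm x) 0.
  by rewrite /dotv big1 ?mulr_ge0 ?enorm_ge0 // => i _; rewrite mxE mul0r.
have [/enorm_eq0 ->|y0] := eqVneq (enorm y) 0.
  by rewrite /dotv big1 ?mulr_ge0 ?enorm_ge0 // => i _; rewrite mxE mulr0.
have xy0 : 0 < enorm x * enorm y by rewrite mulr_gt0 // lt0r ?x0 ?y0 enorm_ge0.
(* The expanded square equals $2|x||y|(|x||y| - \langle x,y\rangle)$; since both norms are nonzero,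
   $|x||y|$ can be divided out. *)
have := dotvv_ge0 (enorm y *: x - enorm x *: y).
rewrite !dotvE -!sqr_enorm (dotvC y x) => h.
rewrite -(ler_pM2l xy0); nra.
Qed.

Lemma enormD x y : enorm (x + y) <= enorm x + enorm y.
Proof.
rewrite -(@ler_pXn2r _ 2) ?nnegrE ?addr_ge0 ?enorm_ge0 //.
rewrite sqr_enorm !dotvE -!sqr_enorm (dotvC y x).
have := dotv_le x y; nra.
Qed.

Lemma enorm_continuous : continuous (@enorm R d).
Proof.
move=> x; apply: continuous_comp; last exact: sqrt_continuous.
apply: (continuous_big add_continuous) => i _ {}x.
have c := @coord_continuous R 1 d ord0 i x.
exact: (continuousM c c).
Qed.

Let continuous_lipschitz_modulus (K : R) x :
  {for x, continuous (fun u => K * enorm (x - u))}.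
Proof.
have xu : {for x, continuous (fun u => x - u)}.
  exact: (continuousB (@cst_continuous _ _ x x) (fun A => id)).
have c := continuous_comp xu (@enorm_continuous _).
exact: (continuousM (@cst_continuous _ _ K x) c).
Qed.

Let lipschitz_modulus0 (K : R) x : K * enorm (x - x) = 0.
Proof. by rewrite subrr enorm0 mulr0. Qed.

Lemma lipschitz_fun_continuous (K : R) (f : 'rV[R]_d -> R) :
  lipschitz_fun K f -> continuous f.
Proof.
by move=> fK x; apply: (@continuous_modulus R _ R f (fun u => K * enorm (x - u))).
Qed.

Lemma enorm_coord x i : `|x ord0 i| <= enorm x.
Proof.
rewrite -sqrtr_sqr ler_sqrt ?dotvv_ge0 // expr2 /dotv (bigD1 i) //= lerDl.
by apply: sumr_ge0 => j _; rewrite -expr2 sqr_ge0.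
Qed.

(** The topology on row vectors comes from the max norm; this comparison turns Euclidean Lipschitz
    bounds on maps into continuity. *)
Lemma norm_le_enorm x : `|x| <= enorm x.
Proof.
rewrite -[`|x|]/(mx_norm x) mx_normrE; apply: bigmax_le => [|[i j] _ /=].
  exact: enorm_ge0.
by rewrite ord1 enorm_coord.
Qed.

Lemma lipschitz_map_continuous (K : R) (T : 'rV[R]_d -> 'rV[R]_d) :
  lipschitz_map K T -> continuous T.
Proof.
move=> TK x; apply: (@continuous_modulus R _ _ T (fun u => K * enorm (x - u))) => //.
by move=> u; apply: le_trans (TK x u); exact: norm_le_enorm.
Qed.

Lemma lipschitz_map_coord (K : R) (T : 'rV[R]_d -> 'rV[R]_d) i :
  lipschitz_map K T -> lipschitz_fun K (fun x => T x ord0 i).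
Proof.
move=> TK u v; apply: le_trans (TK u v).
by have := enorm_coord (T u - T v) i; rewrite !mxE.
Qed.

End EuclideanNorm.

(** * Convex functions with Lipschitz gradient: lower and upper bounds *)

Section ConvexGradient.
Variables (R : realType) (d : nat) (phi : 'rV[R]_d -> R) (T : 'rV[R]_d -> 'rV[R]_d).
Hypothesis phi_convex : forall (x y : 'rV[R]_d) (t : R), 0 <= t <= 1 ->
  phi (t *: x + (1 - t) *: y) <= t * phi x + (1 - t) * phi y.
Hypothesis phi_diff : forall x, differentiable phi x.
Hypothesis phi_grad : forall x v, 'D_v phi x = dotv (T x) v.

(** Convexity bounds the difference quotients of [phi] from [x] towards [y] by [phi y - phi x] for
    steps in $(0,1]$; their limit from the right is the directional derivative. *)
Lemma convex_gradient_le x y : phi x + dotv (T x) (y - x) <= phi y.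
Proof.
rewrite -lerBrDl -phi_grad.
have /cvg_dnbhs_at_right h : (fun t => t^-1 *: (phi (t *: (y - x) + x) - phi x))
    @ (0 : R)^' --> 'D_(y - x) phi x.
  exact: (diff_derivable (phi_diff x)).
apply: (cvgr_to_le h); near=> t.
have t0 : 0 < t by near: t; exact: nbhs_right_gt.
have t1 : t <= 1 by near: t; exact: nbhs_right_le.
rewrite /GRing.scale /= ler_pdivrMl // mulrBr.
have -> : t *: (y - x) + x = t *: y + (1 - t) *: x.
  by rewrite scalerBr scalerBl scale1r -addrA (addrC (- _)).
by have := @phi_convex y x t; rewrite t1 ltW // => /(_ isT); lra.
Unshelve. all: by end_near. Qed.

Variable L : R.
Hypothesis T_lip : lipschitz_map L T.

(* Telescope the gradient inequality along the n subintervals of [x, y]. *)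
Lemma lipschitz_gradient_partition x h n k : (0 < n)%N ->
  phi (x + (k%:R / n%:R) *: h) <= phi x + k%:R / n%:R * dotv (T x) h
    + L * (k%:R * k.+1%:R) / (2 * n%:R ^+ 2) * enorm h ^+ 2.
Proof.
move=> n0; have n0' : (0 : R) < n%:R by rewrite ltr0n.
elim: k => [|k IH]; first by rewrite !mul0r scale0r mulr0 !mul0r !addr0.
set a := k%:R / n%:R in IH *; set b := k.+1%:R / n%:R.
have ba : a - b = - n%:R^-1 by rewrite /a /b -natr1; field; lra.
(* The tangent at the right endpoint, evaluated at the left one, bounds the increment of [phi] from
   above. *)
have := convex_gradient_le (x + b *: h) (x + a *: h).
rewrite opprD addrACA subrr add0r -scalerBl dotvZr ba => grad.
have Tb : dotv (T (x + b *: h)) h <= dotv (T x) h + L * b * enorm h ^+ 2.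
  rewrite -lerBlDl -dotvNl -dotvDl. apply: le_trans (dotv_le _ _) _.
  rewrite expr2 mulrA ler_wpM2r ?enorm_ge0 //; apply: le_trans (T_lip _ _) _.
  rewrite addrAC subrr add0r enormZ ger0_norm ?mulrA //.
  by rewrite /b divr_ge0 // ltW.
have := ler_wpM2l (ltW (_ : 0 < n%:R^-1)) Tb; rewrite invr_gt0 => /(_ n0') Tbn.
have -> : b = a + n%:R^-1 by lra.
have -> : L * (k.+1%:R * k.+2%:R) / (2 * n%:R ^+ 2) =
   L * (k%:R * k.+1%:R) / (2 * n%:R ^+ 2) + L * b / n%:R.
  by rewrite /b -!natr1; field; lra.
move: Tbn grad IH; rewrite mulrDr; set E := enorm h ^+ 2.
rewrite (_ : n%:R^-1 * (L * b * E) = L * b / n%:R * E); last by rewrite mulrC mulrAC.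
rewrite (_ : b *: h = (a + n%:R^-1) *: h); last by congr (_ *: _); lra.
rewrite !mulrDl; lra.
Qed.

(** The partition bound with [k = n] gives the claim up to an error [c / n], and [n] is
    arbitrary. *)
Lemma lipschitz_gradient_le x y :
  phi y <= phi x + dotv (T x) (y - x) + L / 2 * enorm (y - x) ^+ 2.
Proof.
set c := L / 2 * _.
have bound n : (0 < n)%N -> phi y - (phi x + dotv (T x) (y - x) + c) <= c / n%:R.
  move=> n0; have n0' : (n%:R : R) != 0 by rewrite pnatr_eq0 -lt0n.
  have := lipschitz_gradient_partition x (y - x) n n0.
  rewrite divff // scale1r addrC subrK mul1r.
  rewrite (_ : _ / (2 * _) * _ = c + c / n%:R); first by lra.
  by rewrite /c -natr1; field.
rewrite leNgt; apply/negP; rewrite -subr_gt0; set D := phi y - _ => D0.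
have D0' : D <> 0 by move=> D00; rewrite D00 ltxx in D0.
(* An excess [D > 0] is refuted by an [n] above [c / D]; the absolute value covers either sign of
   [c]. *)
have := archi_boundP (normr_ge0 (c / D)); set n := Num.bound _ => cn.
have nn : (0 < n)%N by rewrite -(ltr0n R); apply: le_lt_trans cn.
have := bound n nn; rewrite -/D ler_pdivlMr ?ltr0n //.
have : c / D < n%:R by apply: le_lt_trans cn; exact: ler_norm.
by rewrite ltr_pdivrMr // mulrC; lra.
Qed.

End ConvexGradient.

(** * Truncated Legendre conjugate and Fenchel-Young gap *)

Section TruncatedConjugate.
Variables (R : realType) (d : nat) (phi : 'rV[R]_d -> R) (T : 'rV[R]_d -> 'rV[R]_d).
Variables (L N : R).
Hypothesis gradient_le : forall x y, phi x + dotv (T x) (y - x) <= phi y.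
Hypothesis smooth : forall x y,
  phi y <= phi x + dotv (T x) (y - x) + L / 2 * enorm (y - x) ^+ 2.
Hypothesis N_ge0 : 0 <= N.

(* Restricting the supremum in the Legendre transform to a ball keeps it
   finite and Lipschitz everywhere, hence Borel. *)
Definition trunc_conj (y : 'rV[R]_d) : R :=
  sup [set r | exists2 x, enorm x <= N & r = dotv x y - phi x].

(** Collects what remains after $\langle x,y\rangle \le |x|^2/2 + |y|^2/2$ and $\varphi(x) \ge
    \varphi(0) - |T(0)||x|$ are applied with $|x| \le N$. *)
Definition trunc_conj_bound : R := N ^+ 2 / 2 + N * enorm (T 0) - phi 0.

Let conj_le x y : enorm x <= N ->
  dotv x y - phi x <= enorm y ^+ 2 / 2 + trunc_conj_bound.
Proof.
move=> xN; have := gradient_le 0 x; rewrite subr0 => phi0.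
have := dotv_le x y; have := dotv_le (- T 0) x; rewrite dotvNl enormN => T0 xy.
have x0 := enorm_ge0 x; have := enorm_ge0 (T 0) => T00.
have := ler_wpM2l T00 xN; have := @ler_pM _ _ _ _ _ x0 x0 xN xN.
have := sqr_ge0 (enorm x - enorm y); rewrite /trunc_conj_bound; nra.
Qed.

Lemma trunc_conj_ge x y : enorm x <= N -> dotv x y - phi x <= trunc_conj y.
Proof.
move=> xN; apply: ub_le_sup; last by exists x.
by exists (enorm y ^+ 2 / 2 + trunc_conj_bound) => _ [z zN ->]; exact: conj_le.
Qed.

Lemma trunc_conj_le y b :
  (forall x, enorm x <= N -> dotv x y - phi x <= b) -> trunc_conj y <= b.
Proof.
move=> h; apply: ge_sup; last by move=> _ [x xN ->]; exact: h.
by exists (dotv 0 y - phi 0), 0 => //; rewrite enorm0.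
Qed.

Lemma trunc_conj_le_bound y :
  trunc_conj y <= enorm y ^+ 2 / 2 + trunc_conj_bound.
Proof. by apply: trunc_conj_le => x; exact: conj_le. Qed.

(** A supremum of affine functions whose slopes have norm at most [N]. *)
Lemma trunc_conj_lipschitz : lipschitz_fun N trunc_conj.
Proof.
suff h u v : trunc_conj u - trunc_conj v <= N * enorm (u - v).
  move=> u v; rewrite ler_norml h andbT lerNl opprB.
  by rewrite -(enormN (u - v)) opprB h.
rewrite lerBlDl; apply: trunc_conj_le => x xN.
have := trunc_conj_ge v xN; have := dotv_le x (u - v); rewrite dotvDr dotvNr.
have := ler_wpM2r (enorm_ge0 (u - v)) xN; lra.
Qed.

(** By the gradient inequality, $z \mapsto \langle z,T(x)\rangle - \varphi(z)$ is maximal at [x]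
    over the whole space, so the truncated supremum stays below this value even when [x] lies
    outside the ball. *)
Lemma trunc_conj_gradient_le x : trunc_conj (T x) <= dotv x (T x) - phi x.
Proof.
apply: trunc_conj_le => z _; have := gradient_le x z.
by rewrite !(dotvC _ (T x)) dotvDr dotvNr; lra.
Qed.

(* Test the supremum at x + (y - T x) / L, the minimiser of the quadratic
   upper bound for phi. *)
Lemma fenchel_young_gap x y : 0 < L -> enorm (x + L^-1 *: (y - T x)) <= N ->
  enorm (y - T x) ^+ 2 / (2 * L) <= phi x + trunc_conj y - dotv x y.
Proof.
move=> L0 /(trunc_conj_ge y); have := smooth x (x + L^-1 *: (y - T x)).
rewrite (addrC x) addrK enormZ exprMn dotvZr dotvDl dotvZl.
rewrite gtr0_norm ?invr_gt0 //.
(* As $y = T(x) + w$, moving from [x] to the test point gains $|w|^2/L$ from the linear terms and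
   loses $|w|^2/(2L)$ to the quadratic bound. *)
set w := y - T x; have -> : dotv w y = dotv (T x) w + enorm w ^+ 2.
  by rewrite sqr_enorm -[in LHS](subrK (T x) y) -/w dotvDr addrC (dotvC w).
set E := enorm w ^+ 2.
have -> : L / 2 * (L^-1 ^+ 2 * E) = E / (2 * L) by field; rewrite gt_eqF.
have e2 : E / L = 2 * (E / (2 * L)) by field; rewrite gt_eqF.
rewrite mulrDr (mulrC L^-1 E) e2; lra.
Qed.

End TruncatedConjugate.

(** * Borel measurability *)

Section BorelMeasurability.
Variables (R : realType) (d : nat).

Lemma Rd_open_measurable (U : set 'rV[R]_d) :
  open U -> measurable (U : set (Rd R d)).
Proof. by move=> oU; exact: sub_sigma_algebra. Qed.

Lemma Rd_continuous_measurable (f : 'rV[R]_d -> R) :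
  continuous f -> measurable_fun setT (f : Rd R d -> R).
Proof.
move=> /continuousP cf; apply: (measurability _ (RGenOpens.measurableE R)).
move=> _ [_ [a [b ->] <-]]; rewrite setTI; apply: Rd_open_measurable.
exact/cf/interval_open.
Qed.

Lemma Rd_lipschitz_measurable K (f : 'rV[R]_d -> R) :
  lipschitz_fun K f -> measurable_fun setT (f : Rd R d -> R).
Proof. by move=> /lipschitz_fun_continuous; exact: Rd_continuous_measurable. Qed.

Lemma coord_lipschitz i : lipschitz_fun 1 (fun x : 'rV[R]_d => x ord0 i).
Proof. by apply: lipschitz_map_coord => u v; rewrite mul1r. Qed.

Lemma enorm_lipschitz : lipschitz_fun 1 (@enorm R d).
Proof.
move=> u v; rewrite mul1r ler_norml lerBlDr lerNl opprB lerBlDr.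
have := enormD (u - v) v; have := enormD (v - u) u.
by rewrite !subrK -(enormN (v - u)) opprB => -> ->.
Qed.

Lemma Rd_lipschitz_map_measurable K (T : 'rV[R]_d -> 'rV[R]_d) :
  lipschitz_map K T -> measurable_fun setT (T : Rd R d -> Rd R d).
Proof.
move=> /lipschitz_map_continuous /continuousP cT.
apply: (@measurability _ _ (Rd R d) (Rd R d) setT T (@open 'rV[R]_d)) => // _ [U oU <-].
by rewrite setTI; apply: Rd_open_measurable; exact: cT.
Qed.

(* Arguing by coordinates avoids having to identify the product of the Borel
   sigma-algebras with the Borel sigma-algebra of the product. *)
Lemma measurable_enormB d' (X : measurableType d') (f g : X -> 'rV[R]_d) :
  (forall i, measurable_fun setT (fun x => f x ord0 i)) ->
  (forall i, measurable_fun setT (fun x => g x ord0 i)) ->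
  measurable_fun setT (fun x => enorm (f x - g x)).
Proof.
move=> mf mg; apply: (measurableT_comp (continuous_measurable_fun (@sqrt_continuous R))).
apply: measurable_sum => i; under eq_fun do rewrite !mxE.
by apply: measurable_funM; apply: measurable_funB.
Qed.

End BorelMeasurability.

(** * Couplings and weak Kantorovich duality *)

Section TransportDuality.
Variables (R : realType) (d : nat) (mu nu : probability (Rd R d) R).
Local Open Scope ereal_scope.

(** The image of [pi] under the first projection agrees with [mu] on measurable sets, so this is a
    change of variables. *)
Lemma coupling_integral_fst pi (f : Rd R d -> \bar R) : coupling mu nu pi ->
  measurable_fun setT f -> (forall x, 0 <= f x) ->
  \int[pi]_z f z.1 = \int[mu]_x f x.
Proof.
move=> [pi1 _] mf f0.
rewrite -[LHS](ge0_integral_pushforward (phi := fst) measurable_fst _ measurableT) //.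
apply: eq_measure_integral => A mA _; apply: etrans (pi1 A mA); congr (pi _).
by apply/seteqP; split => z //= [].
Qed.

Lemma coupling_integral_snd pi (f : Rd R d -> \bar R) : coupling mu nu pi ->
  measurable_fun setT f -> (forall x, 0 <= f x) ->
  \int[pi]_z f z.2 = \int[nu]_y f y.
Proof.
move=> [_ pi2] mf f0.
rewrite -[LHS](ge0_integral_pushforward (phi := snd) measurable_snd _ measurableT) //.
apply: eq_measure_integral => A mA _; apply: etrans (pi2 A mA); congr (pi _).
by apply/seteqP; split => z //= [].
Qed.

Lemma measurable_cost : measurable_fun setT (@cost R d).
Proof.
apply: measurable_funM => //; apply: measurable_funX; apply: measurable_enormB => i.
- exact: (measurableT_comp (Rd_lipschitz_measurable (@coord_lipschitz R d i))
    measurable_fst).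
- exact: (measurableT_comp (Rd_lipschitz_measurable (@coord_lipschitz R d i))
    measurable_snd).
Qed.

Lemma cost_ge0 (z : Rd R d * Rd R d) : (0 <= cost z)%R.
Proof. by rewrite /cost divr_ge0 // sqr_ge0. Qed.

Lemma OT_ge0 : 0 <= OT mu nu.
Proof.
apply: le_ereal_inf_tmp => _ [pi [_ ->]].
by apply: integral_ge0 => z _; rewrite lee_fin cost_ge0.
Qed.

(** The law of $(x, T(x))$ under [mu] is a coupling, hence a competitor in the infimum. *)
Lemma transport_map_OT_le (T : Rd R d -> Rd R d) : measurable_fun setT T ->
  (forall B, measurable B -> mu (T @^-1` B) = nu B) ->
  OT mu nu <= \int[mu]_x (cost (x, T x))%:E.
Proof.
move=> mT push.
have mX : measurable_fun setT (fun x : Rd R d => (x, T x)).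
  by apply: measurable_fun_pair.
pose X := mfun_Sub (mem_set mX).
apply: ereal_inf_lbound; exists (distribution mu X); split.
  split=> [A mA|B mB].
    rewrite /distribution /pushforward /=; congr (mu _).
    by apply/seteqP; split=> x //= [].
  rewrite -push //; congr (mu _).
  by apply/seteqP; split=> x //= [].
rewrite (ge0_integral_distribution X) //.
  by apply/measurable_EFinP; exact: measurable_cost.
by move=> z; rewrite lee_fin cost_ge0.
Qed.

(* A and B are the (shifted) Kantorovich potentials. Shifting makes them
   nonnegative, so no integrability has to be tracked. *)
Lemma duality_gap_le (T : Rd R d -> Rd R d) (A B : Rd R d -> R)
    (g : Rd R d * Rd R d -> R) (K : R)
    (pi : probability (Rd R d * Rd R d)%type R) :
  measurable_fun setT T ->
  (forall B, measurable B -> mu (T @^-1` B) = nu B) ->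
  coupling mu nu pi ->
  measurable_fun setT A -> measurable_fun setT B -> measurable_fun setT g ->
  (forall x, (0 <= A x)%R) -> (forall y, (0 <= B y)%R) ->
  (forall z, (0 <= g z)%R) ->
  (0 <= K)%R ->
  (forall x, (cost (x, T x) + K <= A x + B (T x))%R) ->
  {ae pi, forall z, (A z.1 + B z.2 + g z <= cost z + K)%R} ->
  OT mu nu + \int[pi]_z (g z)%:E <= \int[pi]_z (cost z)%:E.
Proof.
move=> mT push cpl mA mB mg A0 B0 g0 K0 upper lower.
have mc : measurable_fun setT (EFin \o @cost R d).
  by apply/measurable_EFinP; exact: measurable_cost.
have mEA : measurable_fun setT (EFin \o A) by exact/measurable_EFinP.
have mEB : measurable_fun setT (EFin \o B) by exact/measurable_EFinP.
have mEg : measurable_fun setT (EFin \o g) by exact/measurable_EFinP.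
have mA1 := measurableT_comp mEA (@measurable_fst _ _ (Rd R d) (Rd R d)).
have mB2 := measurableT_comp mEB (@measurable_snd _ _ (Rd R d) (Rd R d)).
have c0 (z : Rd R d * Rd R d) : 0 <= (cost z)%:E by rewrite lee_fin cost_ge0.
have intK d' (X : measurableType d') (P : probability X R) : \int[P]_x K%:E = K%:E.
  by rewrite integral_cst // [X in _ * X]probability_setT mule1.
(* Adding the finite [K] is reversible, and it can be absorbed into an integral because a
   probability integrates [K] to itself. *)
rewrite -(@leeD2rE _ K%:E) //.
have -> : \int[pi]_z (cost z)%:E + K%:E = \int[pi]_z (cost z + K)%:E.
  rewrite -[X in _ + X](intK _ _ pi) -ge0_integralD //.
apply: (@le_trans _ _ (\int[pi]_z (A z.1 + B z.2 + g z)%:E)); last first.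
  apply: ae_ge0_le_integral => //.
  - by move=> z _; rewrite lee_fin !addr_ge0.
  - apply/measurable_EFinP; apply: measurable_funD => //.
    by apply: measurable_funD; apply/measurable_EFinP.
  - by move=> z _; rewrite lee_fin addr_ge0 // cost_ge0.
  - by apply/measurable_EFinP; apply: measurable_funD => //; exact: measurable_cost.
  - by apply: filterS lower => z; rewrite lee_fin.
(* The marginals send [A] to [mu] and [B] to [nu]; as [nu] is the image of [mu] under [T], both
   potentials end up integrated against [mu]. *)
have -> : \int[pi]_z (A z.1 + B z.2 + g z)%:E =
    \int[mu]_x (A x + B (T x))%:E + \int[pi]_z (g z)%:E.
  under eq_integral do rewrite !EFinD.
  have A1 (z : Rd R d * Rd R d) : 0 <= (A z.1)%:E by rewrite lee_fin.
  have B2 (z : Rd R d * Rd R d) : 0 <= (B z.2)%:E by rewrite lee_fin.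
  have g0' (z : Rd R d * Rd R d) : 0 <= (g z)%:E by rewrite lee_fin.
  rewrite ge0_integralD //; last 2 first.
  - by move=> z _; exact: adde_ge0.
  - exact: emeasurable_funD.
  rewrite ge0_integralD //; congr (_ + _).
  rewrite (coupling_integral_fst cpl mEA) => [|x]; last by rewrite lee_fin.
  rewrite (coupling_integral_snd cpl mEB) => [|x]; last by rewrite lee_fin.
  under [RHS]eq_integral do rewrite EFinD.
  have mBT := measurableT_comp mEB mT.
  rewrite [RHS]ge0_integralD //; last 2 first.
  - by move=> x _; rewrite lee_fin.
  - by move=> x _; rewrite lee_fin.
  congr (_ + _).
  rewrite -[RHS](ge0_integral_pushforward mT mu measurableT mEB); last first.
    by move=> y _; rewrite lee_fin.
  by apply: eq_measure_integral => C mC _; exact: esym (push C mC).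
rewrite addeAC leeD2r //.
have mX : measurable_fun setT (fun x : Rd R d => (x, T x)).
  by apply: measurable_fun_pair.
have mcT : measurable_fun setT (fun x : Rd R d => (cost (x, T x))%:E).
  exact: (measurableT_comp mc mX).
(* [T] competes in [OT], and [upper] compares its shifted cost with the potentials. *)
apply: (@le_trans _ _ (\int[mu]_x (cost (x, T x) + K)%:E)).
  under eq_integral do rewrite EFinD.
  by rewrite ge0_integralD // intK leeD2r // transport_map_OT_le.
apply: ge0_le_integral => //.
- by move=> x _; rewrite lee_fin addr_ge0 // cost_ge0.
- by apply/measurable_EFinP; apply: measurable_funD => //; exact/measurable_EFinP.
- apply/measurable_EFinP; apply: measurable_funD => //.
  by apply: (measurableT_comp mB mT).
- by move=> x _; rewrite lee_fin.
Qed.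

End TransportDuality.

(** * Mean square displacement of a coupling from the graph of [T] *)

Section ConcentrationAroundBrenierMap.
Variables (R : realType) (d : nat) (mu nu : probability (Rd R d) R).
Variables (T : 'rV[R]_d -> 'rV[R]_d) (L : R).
Hypothesis T_lip : lipschitz_map L T.
Local Open Scope ereal_scope.

Let disp (z : Rd R d * Rd R d) : R := enorm ((z.2 : 'rV[R]_d) - T z.1).

Lemma measurable_disp : measurable_fun setT disp.
Proof.
apply: measurable_enormB => i.
- exact: (measurableT_comp (Rd_lipschitz_measurable (@coord_lipschitz R d i))
    measurable_snd).
- exact: (measurableT_comp
    (Rd_lipschitz_measurable (lipschitz_map_coord i T_lip)) measurable_fst).
Qed.

Lemma disp_ge_measurable (t : R) : measurable [set z | (t <= disp z)%R].
Proof.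
rewrite (_ : mkset _ = disp @^-1` `[t, +oo[).
  by rewrite -[X in measurable X]setTI; apply: measurable_disp.
by apply/seteqP; split=> z /=; rewrite in_itv /= andbT.
Qed.

Lemma disp_le_measurable (t : R) : measurable [set z | (disp z <= t)%R].
Proof.
rewrite (_ : mkset _ = disp @^-1` `]-oo, t]).
  by rewrite -[X in measurable X]setTI; apply: measurable_disp.
by apply/seteqP; split=> z /=; rewrite in_itv.
Qed.

Lemma disp_markov (pi : probability (Rd R d * Rd R d)%type R) (t : R) :
  (0 < t)%R ->
  (t ^+ 2)%:E * pi [set z | (t <= disp z)%R] <= \int[pi]_z (disp z ^+ 2)%:E.
Proof.
move=> t0; have mS := disp_ge_measurable t.
have mD : measurable_fun setT (fun z => (disp z ^+ 2)%:E).
  by apply/measurable_EFinP; apply: measurable_funX; exact: measurable_disp.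
rewrite -integral_cst //; apply: (@le_trans _ _
  (\int[pi]_(z in [set z | (t <= disp z)%R]) (disp z ^+ 2)%:E)).
  apply: ge0_le_integral => //.
  - by move=> z _; rewrite lee_fin sqr_ge0.
  - exact: measurable_funTS.
  - by move=> z /= tz; rewrite lee_fin ler_pXn2r ?nnegrE ?enorm_ge0 // ltW.
by apply: ge0_subset_integral => // z _; rewrite lee_fin sqr_ge0.
Qed.

(** If [L <= 0] then [T] is constant and [nu] is a Dirac mass, whereas points are Lebesgue-null in
    positive dimension. *)
Lemma ac_lipschitz_gt0 (leb : {measure set (Rd R d) -> \bar R}) :
  (0 < d)%N -> is_lebesgue_measure leb -> nu `<< leb ->
  (forall B : set (Rd R d), measurable B ->
     mu ((T : Rd R d -> Rd R d) @^-1` B) = nu B) -> (0 < L)%R.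
Proof.
move=> d0 lebE ac push; rewrite ltNge; apply/negP => L0.
have Tcst x : T x = T 0%R.
  apply/eqP; rewrite -subr_eq0; apply/eqP/enorm_eq0/eqP.
  rewrite eq_le enorm_ge0 andbT; apply: le_trans (T_lip x 0%R) _.
  by rewrite mulr_le0_ge0 ?enorm_ge0.
set c := T 0%R; pose pt : set (Rd R d) := [set c].
have mpt : measurable pt.
  rewrite (_ : pt = (fun x : Rd R d => enorm ((x : 'rV[R]_d) - c)) @^-1` [set 0%R]).
    rewrite -[X in measurable X]setTI; apply: (_ : measurable_fun setT _) => //.
    apply: (@Rd_lipschitz_measurable R d 1%R) => u v.
    have := @enorm_lipschitz R d (u - c)%R (v - c)%R.
    by rewrite opprB addrA subrK.
  apply/seteqP; split => [x /= ->|x /= /enorm_eq0 /eqP].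
    by rewrite subrr enorm0.
  by rewrite subr_eq0 => /eqP.
have leb0 : leb pt = 0.
  (* The degenerate box with both corners at [c] is the singleton; the coordinate supplied by [d0]
     makes its volume vanish. *)
  have := lebE c c (fun i => lexx _).
  rewrite (bigD1 (Ordinal d0)) //= subrr mul0r => box0; apply: etrans box0; congr (leb _).
  apply/seteqP; split => [x /= -> i|x /= h]; first by rewrite lexx.
  by apply/rowP => i; apply/eqP; rewrite eq_le andbC; exact: h.
have nu0 : nu pt = 0.
  apply: (ac pt) => // A mA Apt; apply/eqP; rewrite eq_le measure_ge0 andbT.
  by rewrite -leb0; apply: le_measure; rewrite ?inE.
have := push _ mpt; rewrite nu0 (_ : _ @^-1` _ = setT).
  by move/eqP; rewrite probability_setT onee_eq0.
by apply/seteqP; split => // x _; exact: Tcst.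
Qed.

Variables (phi : 'rV[R]_d -> R) (Omega : set (Rd R d)).
Hypothesis phi_convex : forall (x y : 'rV[R]_d) (t : R), (0 <= t <= 1 ->
  phi (t *: x + (1 - t) *: y) <= t * phi x + (1 - t) * phi y)%R.
Hypothesis phi_diff : forall x, differentiable phi x.
Hypothesis phi_grad : forall x v, 'D_v phi x = dotv (T x) v.
Hypothesis push : forall B : set (Rd R d), measurable B ->
  mu ((T : Rd R d -> Rd R d) @^-1` B) = nu B.
Hypothesis mOmega : measurable Omega.
Hypothesis Omega_full : mu (~` Omega) = 0.
Hypothesis Omega_ball : Omega `<=` eball 0%R 1%R.
Hypothesis L_gt0 : (0 < L)%R.

(** Radius of a ball containing $T(\Omega)$, because $|x| < 1$ on $\Omega$. *)
Let M : R := (enorm (T 0%R) + L)%R.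

Let image_le x : Omega x -> (enorm (T x) <= M)%R.
Proof.
move=> /Omega_ball; rewrite /eball /= subr0 => x1.
have := enormD (T x - T 0)%R (T 0%R); rewrite subrK => /le_trans; apply.
rewrite addrC lerD2l; apply: le_trans (T_lip _ _) _.
by rewrite subr0 ger_pMr // ltW.
Qed.

(** [mu] is carried by [Omega], and its image [nu] by the ball of radius [M]; each null set of a
    marginal lifts to a [pi]-negligible strip. *)
Lemma coupling_ae_support pi : coupling mu nu pi ->
  {ae pi, forall z, Omega z.1 /\ (enorm (z.2 : 'rV[R]_d) <= M)%R}.
Proof.
move=> [pi1 pi2].
pose far := [set y : Rd R d | (M < enorm (y : 'rV[R]_d))%R].
have mfar : measurable far.
  rewrite (_ : far = (@enorm R d : Rd R d -> R) @^-1` `]M, +oo[).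
    rewrite -[X in measurable X]setTI; apply: (_ : measurable_fun setT _) => //.
    exact: Rd_lipschitz_measurable (@enorm_lipschitz R d).
  by apply/seteqP; split => y /=; rewrite in_itv /= andbT.
have nu_far : nu far = 0.
  rewrite -push //; apply: (subset_measure0 _ _ _ Omega_full).
  - rewrite -[X in measurable X]setTI.
    exact: (Rd_lipschitz_map_measurable T_lip).
  - exact: measurableC.
  - by move=> x; rewrite /far /= => Mx /image_le; rewrite leNgt Mx.
have n1 : pi.-negligible (~` Omega `*` setT).
  apply/negligibleP; first by apply: measurableX => //; exact: measurableC.
  by apply: etrans (pi1 _ _) Omega_full; exact: measurableC.
have n2 : pi.-negligible (setT `*` far).
  apply/negligibleP; first exact: measurableX.
  exact: etrans (pi2 _ mfar) nu_far.
apply: negligibleS (negligibleU n1 n2) => z /= /not_andP[nO|nM]; [left|right] => //.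
by split => //; rewrite /far /= ltNge; apply/negP.
Qed.

(** Duality is applied to shifts of $|x|^2/2 - \varphi$ and $|y|^2/2 - \psi$: the slack in the cost
    inequality is then the Fenchel-Young gap. *)
Lemma coupling_disp_le pi : coupling mu nu pi ->
  OT mu nu + \int[pi]_z (disp z ^+ 2 / (2 * L))%:E <= \int[pi]_z (cost z)%:E.
Proof.
move=> cpl.
have grad := convex_gradient_le phi_convex phi_diff phi_grad.
have smooth := lipschitz_gradient_le phi_convex phi_diff phi_grad T_lip.
(* Large enough for the test point $x + (y - T(x))/L$ to stay in the truncation ball when $|x| \le
   1$ and $|y|, |T(x)| \le M$. *)
pose N : R := (1 + L^-1 * (M + M))%R.
have M0 : (0 <= M)%R by rewrite addr_ge0 ?enorm_ge0 // ltW.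
have Linv0 : (0 <= L^-1)%R by rewrite invr_ge0 ltW.
have N0 : (0 <= N)%R by rewrite addr_ge0 // mulr_ge0 // addr_ge0.
pose psi := trunc_conj phi N.
(* [K2] makes [B] nonnegative everywhere, while [K1] dominates [phi] only on the unit ball. The
   maximum in [A] covers the other points: it can only help the upper inequality, and it is inactive
   [pi]-almost everywhere, where the lower one is required. *)
pose K2 : R := `|trunc_conj_bound phi T N|%R.
pose K1 : R := `|phi 0 + enorm (T 0) + L / 2|%R.
pose A (x : Rd R d) : R :=
  Num.max 0%R (K1 + enorm (x : 'rV[R]_d) ^+ 2 / 2 - phi x)%R.
pose B (y : Rd R d) : R := (K2 + enorm (y : 'rV[R]_d) ^+ 2 / 2 - psi y)%R.
have costE (z : Rd R d * Rd R d) : cost z =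
    (enorm (z.1 : 'rV[R]_d) ^+ 2 / 2 + enorm (z.2 : 'rV[R]_d) ^+ 2 / 2
       - dotv z.1 z.2)%R.
  by rewrite /cost !sqr_enorm !dotvE (dotvC z.2); field.
have msq : measurable_fun setT (fun x : Rd R d => enorm (x : 'rV[R]_d) ^+ 2 / 2)%R.
  apply: measurable_funM => //; apply: measurable_funX.
  exact: Rd_lipschitz_measurable (@enorm_lipschitz R d).
have mphi : measurable_fun setT (phi : Rd R d -> R).
  apply: Rd_continuous_measurable => x; exact: differentiable_continuous.
apply: (@duality_gap_le _ _ mu nu T A B (fun z => disp z ^+ 2 / (2 * L))%R (K1 + K2)) => //.
- exact: Rd_lipschitz_map_measurable T_lip.
- apply: measurable_maxr => //; apply: measurable_funB => //.
  exact: measurable_funD.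
- apply: measurable_funB; first exact: measurable_funD.
  exact: (Rd_lipschitz_measurable (trunc_conj_lipschitz grad N0)).
- by apply: measurable_funM => //; apply: measurable_funX; exact: measurable_disp.
- by move=> x; rewrite le_max lexx.
- move=> y; have := trunc_conj_le_bound grad N0 y.
  rewrite -/psi /B; have := ler_norm (trunc_conj_bound phi T N); rewrite -/K2; lra.
- by move=> z; rewrite divr_ge0 ?sqr_ge0 // mulr_ge0 // ltW.
- by apply: addr_ge0; exact: normr_ge0.
- move=> x; rewrite costE /=.
  have := trunc_conj_gradient_le grad N0 x; rewrite -/psi.
  have : (K1 + enorm (x : 'rV[R]_d) ^+ 2 / 2 - phi x <= A x)%R.
    by rewrite /A le_max lexx orbT.
  rewrite /B; lra.
- apply: negligibleS (coupling_ae_support cpl) => z; apply: contra_not => -[Oz zM].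
  have z1 : (enorm (z.1 : 'rV[R]_d) <= 1)%R.
    by have := Omega_ball Oz; rewrite /eball /= subr0 => /ltW.
  rewrite /= costE /A max_r.
    have : (enorm ((z.1 : 'rV[R]_d) + L^-1 *: ((z.2 : 'rV[R]_d) - T z.1)) <= N)%R.
      apply: le_trans (enormD _ _) _; apply: lerD => //.
      rewrite enormZ gtr0_norm ?invr_gt0 // ler_wpM2l //.
      by apply: le_trans (enormD _ _) _; rewrite enormN lerD // image_le.
    move=> /(fenchel_young_gap grad smooth L_gt0).
    rewrite -/psi /B /disp; lra.
  (* The quadratic bound from the origin gives [phi <= K1] on the unit ball, so the maximum in [A]
     is its second argument. *)
  have := smooth 0%R z.1; rewrite subr0.
  have := dotv_le (T 0%R) z.1.
  have := ler_norm (phi 0 + enorm (T 0) + L / 2)%R; rewrite -/K1.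
  have e0 := enorm_ge0 (z.1 : 'rV[R]_d).
  have := ler_wpM2l (enorm_ge0 (T 0%R)) z1; rewrite mulr1.
  have : (L / 2 * enorm (z.1 : 'rV[R]_d) ^+ 2 <= L / 2)%R.
    by rewrite ler_piMr ?divr_ge0 ?(ltW L_gt0) // expr_le1.
  have := sqr_ge0 (enorm (z.1 : 'rV[R]_d)).
  lra.
Qed.

End ConcentrationAroundBrenierMap.

(** * Regularized optimizers and the tail bounds *)

(** The quadratic penalty in the objective is nonnegative. *)
Lemma QOT_optimizer_cost_le (R : realType) (d : nat)
    (mu nu : probability (Rd R d) R) (eps : R)
    (pi : probability (Rd R d * Rd R d)%type R) :
  0 <= eps -> is_QOT_optimizer mu nu eps pi ->
  (\int[pi]_z (cost z)%:E <= QOT mu nu eps)%E.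
Proof.
move=> eps0 [_ [f [_ <-]]]; rewrite /QOT_obj leeDl // mule_ge0 ?lee_fin ?divr_ge0 //.
by apply: integral_ge0 => z _; rewrite lee_fin sqr_ge0.
Qed.

(** On the complement of the domain, the density formula integrates over the empty set. *)
Lemma hyp_a_full (R : realType) (d : nat)
    (leb : {measure set (Rd R d) -> \bar R}) (mu : probability (Rd R d) R) :
  hyp_a leb mu -> exists Omega : set (Rd R d),
    [/\ measurable Omega, mu (~` Omega) = 0%E & Omega `<=` eball 0 1].
Proof.
move=> [U [rho [lo [hi [[[oO _] _ _ O1] [_ muE _ _]]]]]].
have mO : measurable (U : set (Rd R d)) by exact: Rd_open_measurable.
exists U; split => //.
have mOC : measurable (~` (U : set (Rd R d))) by exact: measurableC.
by apply: etrans (muE _ mOC) _; rewrite setICl integral_set0.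
Qed.

Unset Implicit Arguments.

Theorem theorem3p9 (R : realType) (d : nat) (d_gt0 : (0 < d)%N)
    (leb : {measure set (Rd R d) -> \bar R})
    (leb_def : is_lebesgue_measure leb)
    (mu nu : probability (Rd R d) R)
    (ha : hyp_a leb mu) (hb : hyp_b leb nu)
    (T : 'rV[R]_d -> 'rV[R]_d) (hT : is_brenier_map mu nu T)
    (L : R) (hL : lipschitz_map L T)
    (Cval : R) (Cval_gt0 : 0 < Cval)
    (hC : forall eps : R, 0 < eps <= 1 ->
       ((Cval^-1 * eps `^ (2 / (2 + d%:R)))%:E <= Delta mu nu eps)%E /\
       (Delta mu nu eps <= (Cval * eps `^ (2 / (2 + d%:R)))%:E)%E) :
  forall (eps : R) (pi : probability (Rd R d * Rd R d)%type R),
    0 < eps <= 1 -> is_QOT_optimizer mu nu eps pi ->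
    (forall t : R, 0 < t ->
       (pi [set z : Rd R d * Rd R d | (t <= enorm ((z.2 : 'rV[R]_d) - T z.1))%R]
        <= ((2 * L * Cval / t ^+ 2) * eps `^ (2 / (d%:R + 2)))%:E)%E) /\
    (forall eta : R, 0 < eta < 1 ->
       ((1 - eta)%:E <=
        pi [set z : Rd R d * Rd R d | (enorm ((z.2 : 'rV[R]_d) - T z.1)
                    <= Num.sqrt (2 * L * Cval) * eta `^ (- (1 / 2))
                       * eps `^ (1 / (d%:R + 2)))%R])%E).
Proof.
move=> eps pi eps01 opt; have /andP[eps0 _] := eps01.
have [U [mO Ofull O1]] := hyp_a_full ha.
have [phi [cvx [dphi push]]] := hT; have [ac _ _] := hb.
have L0 := ac_lipschitz_gt0 hL d_gt0 leb_def ac push.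
have [cpl _] := opt.
have gap := coupling_disp_le hL cvx (fun x => (dphi x).1) (fun x => (dphi x).2)
  push mO Ofull O1 L0 cpl.
have [lo up] := hC eps eps01.
(* An infinite [OT] would make [Delta] equal to $-\infty$, against its real lower bound; finiteness
   is what permits subtracting [OT] below. *)
have OTfin : OT mu nu \is a fin_num.
  rewrite ge0_fin_numE ?OT_ge0 // ltNge leye_eq; apply/negP => /eqP OToo.
  move: lo; rewrite /Delta OToo /= addeNy.
  by rewrite leeNy_eq.
have disp2_le : (\int[pi]_z (enorm ((z.2 : 'rV[R]_d) - T z.1) ^+ 2)%:E <=
    (2 * L * Cval * eps `^ (2 / (d%:R + 2)))%:E)%E.
  have L20 : 0 < 2 * L by rewrite mulr_gt0.
  have := le_trans gap (QOT_optimizer_cost_le (ltW eps0) opt).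
  rewrite -leeBrDl // => /le_trans /(_ up).
  under eq_integral do rewrite mulrC EFinM.
  rewrite ge0_integralZl_EFin //; last 3 first.
  - by move=> z _; rewrite lee_fin sqr_ge0.
  - by apply/measurable_EFinP; apply: measurable_funX; exact: (measurable_disp hL).
  - by rewrite invr_ge0 ltW.
  by rewrite lee_pdivrMl // -EFinM mulrA (addrC 2).
have tail t : 0 < t ->
    (pi [set z : Rd R d * Rd R d | (t <= enorm ((z.2 : 'rV[R]_d) - T z.1))%R]
     <= ((2 * L * Cval / t ^+ 2) * eps `^ (2 / (d%:R + 2)))%:E)%E.
  move=> t0; have := le_trans (disp_markov hL pi t0) disp2_le.
  rewrite -lee_pdivlMl ?exprn_gt0 // -EFinM => /le_trans; apply.
  by rewrite lee_fin mulrA (mulrC (_ ^-1)).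
split=> // eta /andP[eta0 eta1].
set s := _ * eps `^ _.
have C0 : 0 < 2 * L * Cval by rewrite !mulr_gt0.
have s0 : 0 < s by rewrite !mulr_gt0 ?powR_gt0 // sqrtr_gt0.
have d2 : (d%:R + 2 : R) != 0 by rewrite gt_eqF // ltr_wpDl.
(* With this value of $s^2$ the tail bound at [t = s] is exactly [eta]. *)
have s2 : s ^+ 2 = 2 * L * Cval * eta^-1 * eps `^ (2 / (d%:R + 2)).
  rewrite /s !exprMn sqr_sqrtr ?(ltW C0) // -!powR_mulrn ?powR_ge0 // -!powRrM.
  rewrite (_ : - (1 / 2) * 2%:R = -1); last by field.
  by rewrite powR_inv1 ?(ltW eta0) // mul1r (mulrC _^-1).
have mfar := disp_ge_measurable hL s.
set far := [set z | _] in mfar.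
have far_le : (pi far <= eta%:E)%E.
  apply: le_trans (tail s s0) _; rewrite lee_fin s2 le_eqVlt; apply/orP; left.
  apply/eqP; move: (_ * Cval) (eps `^ _) C0 (powR_gt0 (2 / (d%:R + 2)) eps0) => k p k0 p0.
  by field; rewrite !gt_eqF.
(* The complement of [far] is the strict sublevel set, contained in the closed one of the claim. *)
apply: (@le_trans _ _ (pi (~` far))).
  by rewrite probability_setC // EFinB leeB.
apply: le_measure; rewrite ?inE.
- exact: measurableC.
- exact: (disp_le_measurable hL s).
- by move=> z /=; rewrite /far /= => /negP; rewrite -ltNge => /ltW.
Qed.
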